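(* Let $k\ge 2$ be a fixed integer and assume the Unbalanced Supersaturation Conjecture for this $k$: there is a constant $c_k>0$ such that every bipartite graph with bipartition $A\sqcup B$, $m$ edges and $t$ cycles of length $2k$, with $m\ge 100k(|A|+|B|+(|A||B|)^{(k+1)/(2k)})$, satisfies $t\ge c_k\, m^{2k}/(|A|^k|B|^k)$. Let $G$ be a graph with $m$ edges, $t$ cycles of length $2k$, and maximum degree $\Delta(G)\le m^{2/(k+1)}$. Fix $A\subseteq V(G)$ and $d\le\Delta(G)$, and let $B$ be the set of vertices $v\in V(G)$ with $|N(v)\cap A|\in[d/2,d]$. Then \[ \frac{d\sqrt{|B|}}{\sqrt{|A|}}\le \widetilde{O}\!\left(m^{1/(k+1)}+t^{1/(2k)}\right). \]
   Context: $N(v)$ is the neighborhood of $v$. $\widetilde{O}$ hides polylogarithmic factors and constants depending on $k$. *)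

(* Defs.v *)
From mathcomp Require Import all_boot all_order all_algebra.
From mathcomp Require Import reals exp.

Set Implicit Arguments.
Unset Strict Implicit.
Unset Printing Implicit Defensive.

Import Order.TTheory GRing.Theory Num.Theory.

Record sgraph := SGraph {
  vertex :> finType;
  adj : rel vertex;
  adj_sym : symmetric adj;
  adj_irrefl : irreflexive adj
}.

Section Graph.
Variable G : sgraph.

Definition neighborhood (v : G) : {set G} := [set w | adj v w].

Definition max_degree : nat := \max_(v : G) #|neighborhood v|.

Definition edges : {set {set G}} :=
  [set E : {set G} | [exists x, exists y, adj x y && (E == [set x; y])]].

Definition edges_of_cycle (p : seq G) : {set {set G}} :=
  [set [set x; next p x] | x in p].

(* A cycle is a subgraph, recorded by its edge set, so that the choice of a   *)
(* starting vertex and of a direction is not counted. For l >= 3 the edge set *)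
(* determines the cycle.                                                      *)
Definition cycles_of_length (l : nat) : {set {set {set G}}} :=
  [set edges_of_cycle p | p : l.-tuple G & ucycleb (@adj G) p].

Definition bipartition (A B : {set G}) : Prop :=
  [/\ A :|: B = [set: G], [disjoint A & B] &
      forall x y : G, adj x y ->
        (x \in A) && (y \in B) || (x \in B) && (y \in A)].

End Graph.

Local Open Scope ring_scope.

Definition unbalanced_supersaturation (R : realType) (k : nat) : Prop :=
  exists2 c : R, 0 < c &
    forall (G : sgraph) (A B : {set G}), bipartition A B ->
      let a := #|A|%:R : R in
      let b := #|B|%:R : R in
      let m := #|edges G|%:R : R in
      let t := #|cycles_of_length G (2 * k)|%:R : R in
      100 * k%:R * (a + b + (a * b) `^ ((k + 1)%:R / (2 * k)%:R)) <= m ->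
      c * (m ^+ (2 * k) / (a ^+ k * b ^+ k)) <= t.

Definition degree_class (R : realType) (G : sgraph) (A : {set G}) (d : R) :
    {set G} :=
  [set v : G | d / 2 <= #|neighborhood v :&: A|%:R <= d].

(* Main.v *)
Require Import Defs.
From mathcomp Require Import all_boot all_order all_algebra.
From mathcomp Require Import reals exp.
From mathcomp Require Import ring lra.

Set Implicit Arguments.
Unset Strict Implicit.
Unset Printing Implicit Defensive.

Import Order.TTheory GRing.Theory Num.Theory.
Local Open Scope ring_scope.

(**
Write [e(A, B)] for the number of pairs [(x, y)] with [x \in A], [y \in B] and
[adj x y]. Since every vertex of [B] has at least [d / 2] neighbours in [A],
the quantity to bound is at most twice the density [e(A, B) / sqrt (|A||B|)],
and this density is [O(m ^ (1/(k+1)) + t ^ (1/2k))] for any two sets [A], [B].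
A random cut yields disjoint subsets [A'] of [A] and [B'] of [B] with
[e(A, B) <= 4 e(A', B')], so that one may assume [A] and [B] disjoint. If
supersaturation applies to the bipartite graph between them, it bounds the
[2k]-th power of the density by a multiple of [t]. Otherwise [e(A, B)] is at
most a constant times [|A|], [|B|] or [(|A||B|) ^ ((k+1)/2k)]. In the first two
cases the bounds [e(A, B) <= |B| Delta] and [e(A, B) <= |A| Delta] show that the
square of the density is [O(Delta)]; in the third one its [(k+1)]-st power is
[O(e(A, B))]. No logarithmic factor is lost.
*)

Section InjectiveHomomorphism.
Variables (H G : sgraph) (f : H -> G).
Hypotheses (f_inj : injective f) (f_adj : {homo f : x y / adj x y}).

Lemma leq_card_edges : (#|edges H| <= #|edges G|)%N.
Proof.
rewrite -(card_imset _ (imset_inj f_inj)); apply/subset_leq_card/subsetP => E.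
case/imsetP => F; rewrite inE => /existsP[x /existsP[y /andP[xy /eqP->]]] ->.
rewrite inE; apply/existsP; exists (f x); apply/existsP; exists (f y).
by rewrite f_adj //= imsetU !imset_set1.
Qed.

Lemma edges_of_cycle_map (p : seq H) : uniq p ->
  edges_of_cycle (map f p) = [set f @: E | E : {set H} in edges_of_cycle p].
Proof.
move=> Up; apply/setP => E; apply/imsetP/imsetP.
  case=> _ /mapP[x xp ->] ->; exists [set x; next p x]; first exact: imset_f.
  by rewrite next_map // imsetU !imset_set1.
case=> _ /imsetP[x xp ->] ->; exists (f x); first exact: map_f.
by rewrite next_map // imsetU !imset_set1.
Qed.

Lemma leq_card_cycles_of_length (l : nat) :
  (#|cycles_of_length H l| <= #|cycles_of_length G l|)%N.
Proof.
rewrite -(card_imset _ (imset_inj (imset_inj f_inj))).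
apply/subset_leq_card/subsetP => E /imsetP[_ /imsetP[p + ->] ->].
rewrite !inE => /andP[pc pu].
apply/imsetP; exists (map_tuple f p); last by rewrite edges_of_cycle_map.
rewrite !inE /ucycleb /= map_inj_uniq // pu andbT.
exact: (homo_cycle f_adj).
Qed.

End InjectiveHomomorphism.

Lemma card_set_interval (T : finType) (S U : {set T}) : S \subset U ->
  #|[set X : {set T} | S \subset X & X \subset U]| = (2 ^ #|U :\: S|)%N.
Proof.
move=> sSU; rewrite -card_powerset.
have unionK : {in powerset (U :\: S), cancel (setU S) (fun X => X :\: S)}.
  move=> Y; rewrite powersetE subsetD => /andP[_ dYS].
  by rewrite setDUl setDv set0U; apply/setDidPl.
rewrite -(card_in_imset (can_in_inj unionK)); congr #|pred_of_set _|.
apply/setP => X; rewrite inE; apply/andP/imsetP => [[sSX sXU]|[Y + ->]].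
  exists (X :\: S); first by rewrite powersetE setSD.
  by rewrite -[in LHS](setID X S) (setIidPr sSX).
rewrite powersetE subsetD => /andP[sYU _].
by rewrite subsetUl subUset sSU.
Qed.

Lemma card_separating_sets (T : finType) (x y : T) : x != y ->
  (4 * #|[set X : {set T} | (x \in X) && (y \notin X)]| = 2 ^ #|T|)%N.
Proof.
move=> xy.
have -> : [set X : {set T} | (x \in X) && (y \notin X)] =
    [set X : {set T} | [set x] \subset X & X \subset [set~ y]].
  apply/setP => X; rewrite !inE sub1set subsets_disjoint setCK.
  by rewrite disjoint_sym disjoints1.
rewrite card_set_interval ?sub1set ?inE // -(cardsC [set x; y]) cards2 xy.
by rewrite expnD; congr (_ * 2 ^ #|pred_of_set _|)%N; rewrite setDE setCU setIC.
Qed.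

Lemma exists_leq_sum (I : finType) (F : I -> nat) : (0 < #|I|)%N ->
  exists i, (\sum_j F j <= #|I| * F i)%N.
Proof.
move=> /(bigop.eq_bigmax F)[i maxF]; exists i.
by rewrite -sum_nat_const -maxF; apply: leq_sum => j _; apply: leq_bigmax.
Qed.

Lemma exists_cut (T : finType) (P : {set T * T}) :
  {in P, forall p, p.1 != p.2} ->
  exists X : {set T},
    (#|P| <= 4 * #|[set p in P | (p.1 \in X) && (p.2 \notin X)]|)%N.
Proof.
move=> irrP; pose cut (X : {set T}) :=
  [set p in P | (p.1 \in X) && (p.2 \notin X)].
have card_sets : #|{set T}| = (2 ^ #|T|)%N.
  by rewrite -!cardsT -card_powerset powersetT.
have total : (\sum_(X : {set T}) 4 * #|cut X| = #|{set T}| * #|P|)%N.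
  rewrite -big_distrr /=.
  under eq_bigr => X _ do rewrite -sum1dep_card big_mkcondr /=.
  rewrite exchange_big big_distrr card_sets mulnC -sum_nat_const.
  apply: eq_bigr => p /irrP p12; rewrite -(card_separating_sets p12).
  by rewrite -big_mkcond sum1dep_card.
have sets_gt0 : (0 < #|{set T}|)%N by rewrite card_sets expn_gt0.
have [X] := exists_leq_sum (fun X => 4 * #|cut X|)%N sets_gt0.
by rewrite total leq_pmul2l // => ?; exists X.
Qed.

Section AdjacentPairs.
Variable G : sgraph.
Implicit Types A B : {set G}.

Definition adj_pairs A B : {set G * G} :=
  [set p | [&& p.1 \in A, p.2 \in B & adj p.1 p.2]].

Lemma card_adj_pairs A B :
  #|adj_pairs A B| = (\sum_(y in B) #|neighborhood y :&: A|)%N.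
Proof.
rewrite -sum1dep_card -(pair_big_dep xpredT
  (fun x y => [&& x \in A, y \in B & adj x y]) (fun _ _ => 1%N)) /=.
rewrite (exchange_big_dep (mem B)) /=; last by move=> x y _ /and3P[].
apply: eq_bigr => y yB; rewrite -sum1_card; apply: eq_bigl => x.
by rewrite !inE yB adj_sym andbC.
Qed.

Lemma card_adj_pairsC A B : #|adj_pairs A B| = #|adj_pairs B A|.
Proof.
have swapK : involutive (fun p : G * G => (p.2, p.1)) by case.
rewrite -(card_imset _ (inv_inj swapK)); congr #|pred_of_set _|.
apply/setP => -[x y]; rewrite inE /=; apply/imsetP/and3P.
  by case=> -[u v]; rewrite inE /= adj_sym => /and3P[? ? ?] [-> ->].
by case=> xB yA xy; exists (y, x); rewrite // inE /= yA xB adj_sym.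
Qed.

Lemma card_adj_pairs_leM A B : (#|adj_pairs A B| <= #|A| * #|B|)%N.
Proof.
rewrite -cardsX; apply/subset_leq_card/subsetP => p.
by rewrite !inE => /and3P[-> ->].
Qed.

Lemma card_adj_pairs_le_max_degree A B :
  (#|adj_pairs A B| <= #|B| * max_degree G)%N.
Proof.
rewrite card_adj_pairs -sum_nat_const; apply: leq_sum => y _.
by apply: leq_trans (leq_bigmax y); apply/subset_leq_card/subsetIl.
Qed.

Lemma exists_disjoint_adj_pairs A B : exists A' B' : {set G},
  [/\ A' \subset A, B' \subset B, [disjoint A' & B'] &
      (#|adj_pairs A B| <= 4 * #|adj_pairs A' B'|)%N].
Proof.
have [|X cutX] := @exists_cut _ (adj_pairs A B).
  move=> [x y]; rewrite inE /= => /and3P[_ _ xy].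
  by apply: contraTneq xy => ->; rewrite adj_irrefl.
exists (A :&: X), (B :\: X); split; rewrite ?subsetIl ?subsetDl //.
  rewrite disjoint_subset; apply/subsetP => x.
  by rewrite !inE => /andP[_ ->].
apply: leq_trans cutX _; rewrite leq_mul2l /=.
apply/subset_leq_card/subsetP => p; rewrite !inE.
by case/andP=> /and3P[-> -> ->] /andP[-> ->].
Qed.

End AdjacentPairs.

Section BipartiteSubgraph.
Variables (G : sgraph) (A B : {set G}).

Definition between_vertex : finType := {x : G | x \in A :|: B}.

Definition between_adj : rel between_vertex := fun u v =>
  adj (val u) (val v) &&
  ((val u \in A) && (val v \in B) || (val u \in B) && (val v \in A)).

Lemma between_adj_sym : symmetric between_adj.
Proof.
move=> u v; rewrite /between_adj adj_sym orbC.
by rewrite [(val u \in B) && _]andbC [(val u \in A) && _]andbC.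
Qed.

Lemma between_adj_irrefl : irreflexive between_adj.
Proof. by move=> u; rewrite /between_adj adj_irrefl. Qed.

Definition between : sgraph := SGraph between_adj_sym between_adj_irrefl.

Definition between_val (u : between) : G := val u.

Lemma between_val_inj : injective between_val.
Proof. exact: val_inj. Qed.

Lemma between_val_adj : {homo between_val : u v / adj u v}.
Proof. by move=> u v /andP[]. Qed.

Lemma card_between_val_preim (D : {set G}) : D \subset A :|: B ->
  #|between_val @^-1: D| = #|D|.
Proof.
move=> /subsetP sD; rewrite -(card_imset _ between_val_inj).
congr #|pred_of_set _|; apply/setP => x; apply/imsetP/idP.
  by case=> u; rewrite inE => uD ->.
by move=> xD; exists (exist _ x (sD x xD)); rewrite ?inE.
Qed.

Lemma imset_edges_between :
  [set between_val @: E | E : {set between} in edges between] =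
  [set [set p.1; p.2] | p in adj_pairs A B].
Proof.
apply/setP => F; apply/imsetP/imsetP => [[E + ->]|[[x y]]].
  rewrite inE => /existsP[u /existsP[v /andP[/andP[uv uvAB] /eqP->]]].
  rewrite imsetU !imset_set1; case/orP: uvAB => /andP[].
    by exists (val u, val v); rewrite // inE; apply/and3P.
  by exists (val v, val u); rewrite 1?setUC // inE adj_sym; apply/and3P.
rewrite inE /= => /and3P[xA yB xy] ->.
have xAB : x \in A :|: B by rewrite inE xA.
have yAB : y \in A :|: B by rewrite inE yB orbT.
pose u : between := exist _ x xAB; pose v : between := exist _ y yAB.
exists [set u; v]; last by rewrite imsetU !imset_set1.
rewrite inE; apply/existsP; exists u; apply/existsP; exists v.
by rewrite eqxx andbT; apply/andP; split; rewrite //= xA yB.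
Qed.

Hypothesis disjAB : [disjoint A & B].

Lemma bipartition_between :
  bipartition (between_val @^-1: A) (between_val @^-1: B).
Proof.
split.
- by apply/setP => u; have := valP u; rewrite !inE.
- rewrite disjoint_subset; apply/subsetP => u; rewrite !inE => uA.
  by rewrite (disjointFr disjAB uA).
- by move=> u v /andP[_]; rewrite !inE.
Qed.

Lemma card_edges_between : #|edges between| = #|adj_pairs A B|.
Proof.
rewrite -(card_imset _ (imset_inj between_val_inj)) imset_edges_between.
apply: card_in_imset => -[x y] [x' y'].
rewrite !inE /= => /and3P[xA yB _] /and3P[x'A y'B _] eq_xy.
have neqAB a b : a \in A -> b \in B -> (a == b) = false.
  move=> aA bB; apply: contraTF bB => /eqP <-.
  by rewrite (disjointFr disjAB aA).
have : x \in [set x'; y'] by rewrite -eq_xy set21.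
have : y \in [set x'; y'] by rewrite -eq_xy set22.
rewrite !inE [y == x']eq_sym (neqAB x' y) // (neqAB x y') // orbF.
by move=> /eqP -> /eqP ->.
Qed.

End BipartiteSubgraph.

Lemma card_adj_pairs_le_edges (G : sgraph) (A B : {set G}) :
  [disjoint A & B] -> (#|adj_pairs A B| <= #|edges G|)%N.
Proof.
move=> /card_edges_between <-.
exact: leq_card_edges (@between_val_inj _ A B) (@between_val_adj _ A B).
Qed.

Lemma ler_wpdivrMr (F : realFieldType) (x y z : F) :
  0 <= y -> 0 <= z -> x <= z * y -> x / y <= z.
Proof.
rewrite le0r => /predU1P[-> z0 _|y0 _]; first by rewrite invr0 mulr0.
by rewrite ler_pdivrMr.
Qed.

Lemma mulr_sqrt_ratio (F : rcfType) (x y z : F) : 0 <= x -> 0 <= y ->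
  z * Num.sqrt y / Num.sqrt x = z * y / Num.sqrt (x * y).
Proof.
move=> x0 y0; rewrite sqrtrM // -[X in _ = z * X / _](sqr_sqrtr y0).
have [->|y_neq0] := eqVneq (Num.sqrt y) 0.
  by rewrite expr0n !(mulr0, mul0r).
by rewrite expr2 mulrA invfM mulrACA divff // mulr1.
Qed.

Section RealPowers.
Variable R : realType.
Implicit Types (x y z : R) (k n : nat).

Lemma powR_rootK x n : 0 <= x -> (0 < n)%N -> (x `^ (1 / n%:R)) ^+ n = x.
Proof.
move=> x0 n0; rewrite -powR_mulrn ?powR_ge0 // -powRrM divfK ?powRr1 //.
by rewrite pnatr_eq0 -lt0n.
Qed.

Lemma ler_mul_powR_root x y z n : 0 <= x -> 0 <= y -> 0 <= z -> (0 < n)%N ->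
  x ^+ n <= z ^+ n * y -> x <= z * y `^ (1 / n%:R).
Proof.
move=> x0 y0 z0 n0 xzy.
rewrite -(@ler_pXn2r _ n) ?nnegrE ?mulr_ge0 ?powR_ge0 //.
by rewrite exprMn powR_rootK.
Qed.

Lemma powR_sqrt_exp x k n : 0 <= x -> (0 < k)%N ->
  (x `^ (n%:R / (2 * k)%:R)) ^+ k = Num.sqrt x ^+ n.
Proof.
move=> x0 k0; rewrite -powR12_sqrt // -!(powR_mulrn _ (powR_ge0 _ _)).
by rewrite -!powRrM natrM; congr (_ `^ _); field; rewrite pnatr_eq0 -lt0n.
Qed.

End RealPowers.

Section EdgeDensity.
Variables (R : realType) (G : sgraph).
Implicit Types (A B : {set G}) (K : R) (k : nat).

Definition edge_density A B : R :=
  #|adj_pairs A B|%:R / Num.sqrt (#|A|%:R * #|B|%:R).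

Definition supersaturation_threshold k A B : R :=
  #|A|%:R + #|B|%:R + (#|A|%:R * #|B|%:R) `^ ((k + 1)%:R / (2 * k)%:R).

Definition density_bound k : R :=
  #|edges G|%:R `^ (1 / (k + 1)%:R) +
  #|cycles_of_length G (2 * k)|%:R `^ (1 / (2 * k)%:R).

Lemma edge_density_ge0 A B : 0 <= edge_density A B.
Proof. by rewrite divr_ge0 ?sqrtr_ge0. Qed.

Lemma edge_densityC A B : edge_density A B = edge_density B A.
Proof. by rewrite /edge_density card_adj_pairsC [#|A|%:R * _]mulrC. Qed.

Lemma edge_density_exprM2 A B k : edge_density A B ^+ (2 * k) =
  #|adj_pairs A B|%:R ^+ (2 * k) / (#|A|%:R ^+ k * #|B|%:R ^+ k).
Proof.
by rewrite expr_div_n [Num.sqrt _ ^+ _]exprM sqr_sqrtr ?mulr_ge0 // exprMn.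
Qed.

Lemma edge_density_subset_le A B (A' B' : {set G}) (n : nat) :
    A' \subset A -> B' \subset B ->
    (#|adj_pairs A B| <= n * #|adj_pairs A' B'|)%N ->
  edge_density A B <= n%:R * edge_density A' B'.
Proof.
move=> /subset_leq_card leA /subset_leq_card leB le_pairs.
have [pairs0|pairs_gt0] := posnP #|adj_pairs A' B'|.
  rewrite /edge_density pairs0 mul0r mulr0.
  by move: le_pairs; rewrite pairs0 muln0 leqn0 => /eqP ->; rewrite mul0r.
have prod_gt0 : (0 < #|A'| * #|B'|)%N.
  exact: leq_trans pairs_gt0 (card_adj_pairs_leM _ _).
have le_prod : (#|A'| * #|B'| <= #|A| * #|B|)%N by rewrite leq_mul.
rewrite /edge_density -!natrM mulrA -natrM.
apply: ler_pM; rewrite ?invr_ge0 ?sqrtr_ge0 ?ler_nat //.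
by rewrite lef_pV2 ?posrE ?sqrtr_gt0 ?ltr0n ?(leq_trans prod_gt0) //
           ler_sqrt // ler_nat.
Qed.

Lemma edge_density_sqr_le_max_degree A B K : 0 <= K ->
  #|adj_pairs A B|%:R <= K * #|A|%:R ->
  edge_density A B ^+ 2 <= K * (max_degree G)%:R.
Proof.
move=> K0 leA; rewrite (edge_density_exprM2 A B 1) !expr1 invfM mulrACA.
apply: ler_pM; rewrite ?divr_ge0 //; apply: ler_wpdivrMr => //.
by rewrite -natrM ler_nat mulnC card_adj_pairs_le_max_degree.
Qed.

Lemma edge_density_exprS_le A B K k : (0 < k)%N -> 0 <= K ->
  #|adj_pairs A B|%:R
    <= K * (#|A|%:R * #|B|%:R) `^ ((k + 1)%:R / (2 * k)%:R) ->
  edge_density A B ^+ (k + 1) <= K ^+ k * #|adj_pairs A B|%:R.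
Proof.
move=> k0 K0 le_pairs; rewrite expr_div_n.
apply: ler_wpdivrMr; rewrite ?exprn_ge0 ?sqrtr_ge0 ?mulr_ge0 ?exprn_ge0 //.
rewrite -(powR_sqrt_exp _ _ k0) ?mulr_ge0 // mulrAC -exprMn [leLHS]exprD expr1.
by rewrite ler_wpM2r // lerXn2r ?nnegrE ?mulr_ge0 ?powR_ge0.
Qed.

Lemma edge_density_sparse_le A B K k : (0 < k)%N -> 1 <= K ->
  [disjoint A & B] ->
  (max_degree G)%:R <= #|edges G|%:R `^ (2 / (k + 1)%:R) :> R ->
  #|adj_pairs A B|%:R <= K * supersaturation_threshold k A B ->
  edge_density A B <= 3 * K * #|edges G|%:R `^ (1 / (k + 1)%:R).
Proof.
move=> k0 K1 disjAB le_degree; rewrite /supersaturation_threshold.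
set p := _ `^ ((k + 1)%:R / _); set y := _ `^ (1 / _) => le_pairs.
have K0 : 0 <= 3 * K by lra.
have y0 : 0 <= y by rewrite powR_ge0.
have le_degree_sqr : (max_degree G)%:R <= y ^+ 2.
  by rewrite -powR_mulrn // -powRrM mulrAC mul1r.
have le_of_sqr (x : R) : 0 <= x -> x ^+ 2 <= 3 * K * (max_degree G)%:R ->
    x <= 3 * K * y.
  move=> x0 x_sqr; rewrite -(@ler_pXn2r _ 2) ?nnegrE ?(mulr_ge0 K0 y0) //.
  by apply: le_trans x_sqr _; rewrite exprMn ler_pM // expr2 ler_peMl //; lra.
have [leA|gtA] := leP #|adj_pairs A B|%:R (3 * K * #|A|%:R).
  apply: le_of_sqr (edge_density_ge0 _ _) _.
  exact: edge_density_sqr_le_max_degree leA.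
have [leB|gtB] := leP #|adj_pairs A B|%:R (3 * K * #|B|%:R).
  rewrite card_adj_pairsC in leB; rewrite edge_densityC.
  apply: le_of_sqr (edge_density_ge0 _ _) _.
  exact: edge_density_sqr_le_max_degree leB.
have leAB : #|adj_pairs A B|%:R <= 3 * K * p by lra.
apply: ler_mul_powR_root; rewrite ?edge_density_ge0 ?addn_gt0 ?orbT //.
apply: le_trans (edge_density_exprS_le k0 K0 leAB) _.
apply: ler_pM; rewrite ?exprn_ge0 ?ler_nat ?card_adj_pairs_le_edges //.
by rewrite addn1 exprS ler_peMl ?exprn_ge0 //; lra.
Qed.

End EdgeDensity.

Section Supersaturation.
Variables (R : realType) (k : nat).
Hypotheses (k_gt0 : (0 < k)%N)
  (supersaturation : unbalanced_supersaturation R k).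

Lemma edge_density_supersaturation : exists2 c : R, 0 < c &
  forall (G : sgraph) (A B : {set G}), [disjoint A & B] ->
    100 * k%:R * supersaturation_threshold R k A B <= #|adj_pairs A B|%:R ->
    c * edge_density R A B ^+ (2 * k) <= #|cycles_of_length G (2 * k)|%:R.
Proof.
have [c c0 sat] := supersaturation; exists c => // G A B disjAB dense.
have := sat _ _ _ (bipartition_between disjAB).
rewrite /= !card_between_val_preim ?subsetUl ?subsetUr //.
rewrite card_edges_between // -edge_density_exprM2.
move=> /(_ dense) /le_trans; apply.
rewrite ler_nat; apply: (leq_card_cycles_of_length (@between_val_inj _ A B)).
exact: between_val_adj.
Qed.

Lemma edge_density_disjoint_le : exists2 C : R, 0 < C &
  forall (G : sgraph) (A B : {set G}), [disjoint A & B] ->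
    (max_degree G)%:R <= #|edges G|%:R `^ (2 / (k + 1)%:R) :> R ->
    edge_density R A B <= C * density_bound R G k.
Proof.
have [c c0 sat] := edge_density_supersaturation.
have k1 : 1 <= k%:R :> R by rewrite ler1n.
pose K : R := 3 * (100 * k%:R); pose L : R := c^-1 `^ (1 / (2 * k)%:R).
have L0 : 0 <= L by rewrite powR_ge0.
have K0 : 0 < K by rewrite /K; lra.
exists (K + L) => [|G A B disjAB le_degree]; first lra.
rewrite /density_bound.
set y := _ `^ (1 / (k + 1)%:R); set z := _ `^ (1 / (2 * k)%:R).
have y0 : 0 <= y by rewrite powR_ge0.
have z0 : 0 <= z by rewrite powR_ge0.
have [dense|/ltW sparse] :=
  leP (100 * k%:R * supersaturation_threshold R k A B) #|adj_pairs A B|%:R.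
  apply: (@le_trans _ _ (L * z)); last first.
    by rewrite ler_pM // ?lerDr ?lerDl // ltW.
  have k2_gt0 : (0 < 2 * k)%N by rewrite muln_gt0.
  apply: ler_mul_powR_root; rewrite ?edge_density_ge0 //.
  rewrite powR_rootK ?invr_ge0 ?(ltW c0) //.
  by rewrite ler_pdivlMl // sat.
apply: (@le_trans _ _ (K * y)); last by rewrite ler_pM // ?lerDl // ltW.
by apply: edge_density_sparse_le => //; lra.
Qed.

Lemma edge_density_le : exists2 C : R, 0 < C &
  forall (G : sgraph) (A B : {set G}),
    (max_degree G)%:R <= #|edges G|%:R `^ (2 / (k + 1)%:R) :> R ->
    edge_density R A B <= C * density_bound R G k.
Proof.
have [C C0 disjoint_le] := edge_density_disjoint_le.
exists (4 * C) => [|G A B le_degree]; first lra.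
have [A' [B' [sA sB disj le_pairs]]] := exists_disjoint_adj_pairs A B.
apply: le_trans (edge_density_subset_le R sA sB le_pairs) _.
by rewrite -[leRHS]mulrA ler_wpM2l // disjoint_le.
Qed.

End Supersaturation.

Section DegreeClass.
Variables (R : realType) (G : sgraph) (A : {set G}) (d : R).
Let B := degree_class A d.

Lemma degree_class_adj_pairs : d * #|B|%:R <= 2 * #|adj_pairs A B|%:R.
Proof.
rewrite card_adj_pairs natr_sum mulr_sumr mulr_natr -sumr_const.
by apply: ler_sum => v; rewrite inE => /andP[]; lra.
Qed.

Lemma degree_class_edge_density :
  d * Num.sqrt #|B|%:R / Num.sqrt #|A|%:R <= 2 * edge_density R A B.
Proof.
rewrite mulr_sqrt_ratio // mulrA.
by rewrite ler_wpM2r ?invr_ge0 ?sqrtr_ge0 ?degree_class_adj_pairs.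
Qed.

End DegreeClass.

Theorem lemmaA2 (R : realType) (k : nat) (hk : (2 <= k)%N)
    (hconj : unbalanced_supersaturation R k) :
  exists (C : R) (p : nat), 0 < C /\
    forall (G : sgraph) (A : {set G}) (d : R),
      let m := #|edges G|%:R : R in
      let t := #|cycles_of_length G (2 * k)|%:R : R in
      let B := degree_class A d in
      (max_degree G)%:R <= m `^ (2 / (k + 1)%:R) ->
      d <= (max_degree G)%:R ->
      d * Num.sqrt #|B|%:R / Num.sqrt #|A|%:R
        <= C * (1 + ln (1 + m)) ^+ p
           * (m `^ (1 / (k + 1)%:R) + t `^ (1 / (2 * k)%:R)).
Proof.
have [C C0 density_le] := edge_density_le (ltnW hk) hconj.
exists (2 * C), 0%N; split=> [|G A d m t B le_degree _]; first lra.
rewrite expr0 mulr1 -[leRHS]mulrA.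
apply: le_trans (degree_class_edge_density A d) _.
by rewrite ler_wpM2l // density_le.
Qed.
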